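(* For every instance of every rule of the bisequent calculus BSC-K$_3$ (described in the context), all premisses of the instance are $\mathbf{K}_3$-valid if and only if its conclusion is $\mathbf{K}_3$-valid.
   Context: Formulas are built from propositional atoms with connectives $\neg$ (unary) and $\wedge,\vee,\rightarrow$ (binary). A $\mathbf{K}_3$-valuation is a homomorphism $h$ from formulas to $\{0,u,1\}$ (ordered $0<u<1$) with the strong Kleene operations: $h(\neg\varphi)=1,u,0$ when $h(\varphi)=0,u,1$ respectively; $h(\varphi\wedge\psi)=\min(h(\varphi),h(\psi))$; $h(\varphi\vee\psi)=\max(h(\varphi),h(\psi))$; $h(\varphi\rightarrow\psi)=\max(h(\neg\varphi),h(\psi))$. A sequent is $\Gamma\Rightarrow\Delta$ with $\Gamma,\Delta$ finite (possibly empty) multisets of formulas; a bisequent is an ordered pair of sequents written $\Gamma\Rightarrow\Delta\mid\Pi\Rightarrow\Sigma$. A valuation $h$ satisfies $\Gamma\Rightarrow\Delta\mid\Pi\Rightarrow\Sigma$ iff for some formula $\chi$: $\chi\in\Gamma$ and $h(\chi)\neq1$, or $\chi\in\Delta$ and $h(\chi)=1$, or $\chi\in\Pi$ and $h(\chi)=0$, or $\chi\in\Sigma$ and $h(\chi)\neq0$. The bisequent is $\mathbf{K}_3$-valid iff every $\mathbf{K}_3$-valuation satisfies it. The rules of BSC-K$_3$ (each schema ranges over all formulas $\varphi,\psi$, all multisets $\Gamma,\Delta,\Pi,\Sigma$, and $S$ denotes an arbitrary sequent; ''from $X$ (and $Y$) infer $Z$'' means premisses $X$ ($Y$), conclusion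 $Z$): $(\neg\Rightarrow\mid)$: from $\Gamma\Rightarrow\Delta\mid\Pi\Rightarrow\Sigma,\varphi$ infer $\neg\varphi,\Gamma\Rightarrow\Delta\mid\Pi\Rightarrow\Sigma$. $(\Rightarrow\neg\mid)$: from $\Gamma\Rightarrow\Delta\mid\varphi,\Pi\Rightarrow\Sigma$ infer $\Gamma\Rightarrow\Delta,\neg\varphi\mid\Pi\Rightarrow\Sigma$. $(\mid\neg\Rightarrow)$: from $\Gamma\Rightarrow\Delta,\varphi\mid\Pi\Rightarrow\Sigma$ infer $\Gamma\Rightarrow\Delta\mid\neg\varphi,\Pi\Rightarrow\Sigma$. $(\mid\Rightarrow\neg)$: from $\varphi,\Gamma\Rightarrow\Delta\mid\Pi\Rightarrow\Sigma$ infer $\Gamma\Rightarrow\Delta\mid\Pi\Rightarrow\Sigma,\neg\varphi$. $(\wedge\Rightarrow\mid)$: from $\varphi,\psi,\Gamma\Rightarrow\Delta\mid S$ infer $\varphi\wedge\psi,\Gamma\Rightarrow\Delta\mid S$. $(\Rightarrow\wedge\mid)$: from $\Gamma\Rightarrow\Delta,\varphi\mid S$ and $\Gamma\Rightarrow\Delta,\psi\mid S$ infer $\Gamma\Rightarrow\Delta,\varphi\wedge\psi\mid S$. $(\mid\wedge\Rightarrow)$: from $S\mid\varphi,\psi,\Gamma\Rightarrow\Delta$ infer $S\mid\varphi\wedge\psi,\Gamma\Rightarrow\Delta$. $(\mid\Rightarrow\wedge)$: from $S\mid\Gamma\Rightarrow\Delta,\varphi$ and $S\mid\Gamma\Rightarrow\Delta,\psi$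 infer $S\mid\Gamma\Rightarrow\Delta,\varphi\wedge\psi$. $(\Rightarrow\vee\mid)$: from $\Gamma\Rightarrow\Delta,\varphi,\psi\mid S$ infer $\Gamma\Rightarrow\Delta,\varphi\vee\psi\mid S$. $(\vee\Rightarrow\mid)$: from $\varphi,\Gamma\Rightarrow\Delta\mid S$ and $\psi,\Gamma\Rightarrow\Delta\mid S$ infer $\varphi\vee\psi,\Gamma\Rightarrow\Delta\mid S$. $(\mid\Rightarrow\vee)$: from $S\mid\Gamma\Rightarrow\Delta,\varphi,\psi$ infer $S\mid\Gamma\Rightarrow\Delta,\varphi\vee\psi$. $(\mid\vee\Rightarrow)$: from $S\mid\varphi,\Gamma\Rightarrow\Delta$ and $S\mid\psi,\Gamma\Rightarrow\Delta$ infer $S\mid\varphi\vee\psi,\Gamma\Rightarrow\Delta$. $(\Rightarrow\rightarrow\mid)$: from $\Gamma\Rightarrow\Delta,\psi\mid\varphi,\Pi\Rightarrow\Sigma$ infer $\Gamma\Rightarrow\Delta,\varphi\rightarrow\psi\mid\Pi\Rightarrow\Sigma$. $(\mid\Rightarrow\rightarrow)$: from $\varphi,\Gamma\Rightarrow\Delta\mid\Pi\Rightarrow\Sigma,\psi$ infer $\Gamma\Rightarrow\Delta\mid\Pi\Rightarrow\Sigma,\varphi\rightarrow\psi$. $(\rightarrow\Rightarrow\mid)$: from $\Gamma\Rightarrow\Delta\mid\Pi\Rightarrow\Sigma,\varphi$ and $\psi,\Gamma\Rightarrow\Delta\mid\Pi\Rightarrow\Sigma$ infer $\varphi\rightarrow\psi,\Gamma\Rightarrow\Delta\mid\Pi\Rightarrow\Sigma$.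 $(\mid\rightarrow\Rightarrow)$: from $\Gamma\Rightarrow\Delta,\varphi\mid\Pi\Rightarrow\Sigma$ and $\Gamma\Rightarrow\Delta\mid\psi,\Pi\Rightarrow\Sigma$ infer $\Gamma\Rightarrow\Delta\mid\varphi\rightarrow\psi,\Pi\Rightarrow\Sigma$. *)

(* Defs.v *)
From HB Require Import structures.
From mathcomp Require Import all_boot all_order.
From mathcomp Require Import finmap multiset.

Set Implicit Arguments.
Unset Strict Implicit.
Unset Printing Implicit Defensive.

Local Open Scope mset_scope.

Inductive form (atom : Type) : Type :=
| Atom of atom
| Neg of form atom
| And of form atom & form atom
| Or of form atom & form atom
| Imp of form atom & form atom.

(* [{mset form atom}] requires a choiceType, which is obtained by encoding
   formulas as generic trees. *)
Fixpoint form_encode (atom : Type) (f : form atom) : GenTree.tree atom :=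
  match f with
  | Atom p => GenTree.Leaf p
  | Neg f1 => GenTree.Node 0 [:: form_encode f1]
  | And f1 f2 => GenTree.Node 1 [:: form_encode f1; form_encode f2]
  | Or f1 f2 => GenTree.Node 2 [:: form_encode f1; form_encode f2]
  | Imp f1 f2 => GenTree.Node 3 [:: form_encode f1; form_encode f2]
  end.

Fixpoint form_decode (atom : Type) (t : GenTree.tree atom) :
    option (form atom) :=
  match t with
  | GenTree.Leaf p => Some (Atom p)
  | GenTree.Node 0 [:: t1] => omap (@Neg atom) (form_decode t1)
  | GenTree.Node 1 [:: t1; t2] =>
      if (form_decode t1, form_decode t2) is (Some f1, Some f2)
      then Some (And f1 f2) else None
  | GenTree.Node 2 [:: t1; t2] =>
      if (form_decode t1, form_decode t2) is (Some f1, Some f2)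
      then Some (Or f1 f2) else None
  | GenTree.Node 3 [:: t1; t2] =>
      if (form_decode t1, form_decode t2) is (Some f1, Some f2)
      then Some (Imp f1 f2) else None
  | _ => None
  end.

Lemma form_encodeK (atom : Type) :
  pcancel (@form_encode atom) (@form_decode atom).
Proof. by elim=> //= [f -> | f -> g -> | f -> g -> | f -> g ->]. Qed.

HB.instance Definition _ (atom : choiceType) :=
  Choice.copy (form atom) (pcan_type (@form_encodeK atom)).

Inductive k3val : Type := k3v0 | k3vu | k3v1.

Definition k3val_rank (x : k3val) : nat :=
  match x with k3v0 => 0 | k3vu => 1 | k3v1 => 2 end.

Definition k3val_unrank (n : nat) : option k3val :=
  match n with 0 => Some k3v0 | 1 => Some k3vu | 2 => Some k3v1 | _ => None end.

Lemma k3val_rankK : pcancel k3val_rank k3val_unrank.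
Proof. by case. Qed.

HB.instance Definition _ := Countable.copy k3val (pcan_type k3val_rankK).

Definition k3val_le (x y : k3val) : bool := (k3val_rank x <= k3val_rank y)%N.

Lemma k3val_le_refl : reflexive k3val_le.
Proof. by case. Qed.

Lemma k3val_le_anti : antisymmetric k3val_le.
Proof. by case; case. Qed.

Lemma k3val_le_trans : transitive k3val_le.
Proof. by case; case; case. Qed.

Lemma k3val_le_total : total k3val_le.
Proof. by case; case. Qed.

Fact k3val_display : Order.disp_t. Proof. exact: Order.Disp tt tt. Qed.

HB.instance Definition _ := Order.Le_isPOrder.Build k3val_display k3val
  k3val_le_refl k3val_le_anti k3val_le_trans.
HB.instance Definition _ :=
  Order.POrder_isTotal.Build k3val_display k3val k3val_le_total.

Definition k3neg (x : k3val) : k3val :=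
  match x with k3v0 => k3v1 | k3vu => k3vu | k3v1 => k3v0 end.

Definition K3_valuation (atom : Type) (h : form atom -> k3val) : Prop :=
  [/\ forall f, h (Neg f) = k3neg (h f),
      forall f g, h (And f g) = Order.min (h f) (h g),
      forall f g, h (Or f g) = Order.max (h f) (h g)
    & forall f g, h (Imp f g) = Order.max (h (Neg f)) (h g)].

Record sequent (atom : choiceType) : Type := Sequent
  { antecedent : {mset form atom}; succedent : {mset form atom} }.

Record bisequent (atom : choiceType) : Type := Bisequent
  { seq1 : sequent atom; seq2 : sequent atom }.

Declare Scope bisequent_scope.
Delimit Scope bisequent_scope with bseq.
Bind Scope bisequent_scope with sequent bisequent.

Notation "G =>> D" := (Sequent G%mset D%mset)
  (at level 62, no associativity) : bisequent_scope.
Notation "S ||| T" := (Bisequent S T)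
  (at level 64, no associativity) : bisequent_scope.

Local Open Scope bisequent_scope.

Definition K3_satisfies (atom : choiceType) (h : form atom -> k3val)
    (B : bisequent atom) : Prop :=
  let: (G =>> D ||| P =>> Q) := B in
  exists f : form atom,
    [\/ f \in G /\ h f <> k3v1,
        f \in D /\ h f = k3v1,
        f \in P /\ h f = k3v0
      | f \in Q /\ h f <> k3v0].

Definition K3_valid (atom : choiceType) (B : bisequent atom) : Prop :=
  forall h : form atom -> k3val, K3_valuation h -> K3_satisfies h B.

(* [BSC_K3 prems concl] holds iff [prems] and [concl] are the premisses and the
   conclusion of an instance of a rule.  The suffix 1 or 2 tells the component
   (first or second sequent) of the principal formula; L and R tell its side.
   As contexts are multisets, added formulas are written in front of them on
   both sides of the arrow. *)
Inductive BSC_K3 (atom : choiceType) :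
    seq (bisequent atom) -> bisequent atom -> Prop :=
| NegL1 (f : form atom) (G D P Q : {mset form atom}) :
    BSC_K3 [:: G =>> D ||| P =>> f +` Q]
           (Neg f +` G =>> D ||| P =>> Q)
| NegR1 (f : form atom) (G D P Q : {mset form atom}) :
    BSC_K3 [:: G =>> D ||| f +` P =>> Q]
           (G =>> Neg f +` D ||| P =>> Q)
| NegL2 (f : form atom) (G D P Q : {mset form atom}) :
    BSC_K3 [:: G =>> f +` D ||| P =>> Q]
           (G =>> D ||| Neg f +` P =>> Q)
| NegR2 (f : form atom) (G D P Q : {mset form atom}) :
    BSC_K3 [:: f +` G =>> D ||| P =>> Q]
           (G =>> D ||| P =>> Neg f +` Q)
| AndL1 (f g : form atom) (G D : {mset form atom}) (S : sequent atom) :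
    BSC_K3 [:: f +` (g +` G) =>> D ||| S]
           (And f g +` G =>> D ||| S)
| AndR1 (f g : form atom) (G D : {mset form atom}) (S : sequent atom) :
    BSC_K3 [:: G =>> f +` D ||| S; G =>> g +` D ||| S]
           (G =>> And f g +` D ||| S)
| AndL2 (f g : form atom) (G D : {mset form atom}) (S : sequent atom) :
    BSC_K3 [:: S ||| f +` (g +` G) =>> D]
           (S ||| And f g +` G =>> D)
| AndR2 (f g : form atom) (G D : {mset form atom}) (S : sequent atom) :
    BSC_K3 [:: S ||| G =>> f +` D; S ||| G =>> g +` D]
           (S ||| G =>> And f g +` D)
| OrR1 (f g : form atom) (G D : {mset form atom}) (S : sequent atom) :
    BSC_K3 [:: G =>> f +` (g +` D) ||| S]
           (G =>> Or f g +` D ||| S)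
| OrL1 (f g : form atom) (G D : {mset form atom}) (S : sequent atom) :
    BSC_K3 [:: f +` G =>> D ||| S; g +` G =>> D ||| S]
           (Or f g +` G =>> D ||| S)
| OrR2 (f g : form atom) (G D : {mset form atom}) (S : sequent atom) :
    BSC_K3 [:: S ||| G =>> f +` (g +` D)]
           (S ||| G =>> Or f g +` D)
| OrL2 (f g : form atom) (G D : {mset form atom}) (S : sequent atom) :
    BSC_K3 [:: S ||| f +` G =>> D; S ||| g +` G =>> D]
           (S ||| Or f g +` G =>> D)
| ImpR1 (f g : form atom) (G D P Q : {mset form atom}) :
    BSC_K3 [:: G =>> g +` D ||| f +` P =>> Q]
           (G =>> Imp f g +` D ||| P =>> Q)
| ImpR2 (f g : form atom) (G D P Q : {mset form atom}) :
    BSC_K3 [:: f +` G =>> D ||| P =>> g +` Q]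
           (G =>> D ||| P =>> Imp f g +` Q)
| ImpL1 (f g : form atom) (G D P Q : {mset form atom}) :
    BSC_K3 [:: G =>> D ||| P =>> f +` Q; g +` G =>> D ||| P =>> Q]
           (Imp f g +` G =>> D ||| P =>> Q)
| ImpL2 (f g : form atom) (G D P Q : {mset form atom}) :
    BSC_K3 [:: G =>> f +` D ||| P =>> Q; G =>> D ||| g +` P =>> Q]
           (G =>> D ||| Imp f g +` P =>> Q).

(* Main.v *)
Require Import Defs.
From mathcomp Require Import all_boot.
From mathcomp Require Import finmap multiset.
From Stdlib Require List.

Local Open Scope mset_scope.

(** Every rule preserves satisfaction under each single valuation, in both
    directions: satisfaction of a bisequent is a disjunction over its formulas,
    and for each connective the disjunct contributed by the principal formula
    equals the conjunction over the premisses of the disjuncts contributed by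
    the side formulas.  Validity follows by quantifying over valuations. *)

Lemma has_mset1U (K : choiceType) (a : pred K) (x : K) (A : {mset K}) :
  has a (x +` A) = a x || has a A.
Proof.
apply/hasP/orP => [[y] | [ax | /hasP[y yA ay]]].
- rewrite in_msetE in_mset1 => /orP[/eqP-> | yA ay]; first by left.
  by right; apply/hasP; exists y.
- by exists x => //; rewrite in_msetE in_mset1 eqxx.
- by exists y => //; rewrite in_msetE yA orbT.
Qed.

(** Boolean form of satisfaction: each rule then becomes an equation between booleans, provable by
    case analysis. *)
Definition satisfiesb {atom : choiceType} (h : form atom -> k3val)
    (B : bisequent atom) : bool :=
  let: Bisequent (Sequent G D) (Sequent P Q) := B in
  [|| has (fun f => h f != k3v1) G, has (fun f => h f == k3v1) D,
      has (fun f => h f == k3v0) P | has (fun f => h f != k3v0) Q].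

Lemma satisfiesP (atom : choiceType) (h : form atom -> k3val)
    (B : bisequent atom) :
  reflect (K3_satisfies h B) (satisfiesb h B).
Proof.
case: B => [[G D] [P Q]] /=; apply: (iffP idP) => [/or4P[] | [f]].
- by case/hasP=> f fG /eqP hf; exists f; constructor 1.
- by case/hasP=> f fD /eqP hf; exists f; constructor 2.
- by case/hasP=> f fP /eqP hf; exists f; constructor 3.
- by case/hasP=> f fQ /eqP hf; exists f; constructor 4.
case=> -[fA /eqP hf]; apply/or4P;
  [constructor 1 | constructor 2 | constructor 3 | constructor 4];
  by apply/hasP; exists f.
Qed.

Lemma BSC_K3_satisfies {atom : choiceType} {h : form atom -> k3val}
    {prems : seq (bisequent atom)} {concl : bisequent atom} :
  K3_valuation h -> BSC_K3 prems concl ->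
  all (satisfiesb h) prems = satisfiesb h concl.
Proof.
case=> hN hA hO hI.
case=> [f|f|f|f|f g|f g|f g|f g|f g|f g|f g|f g|f g|f g|f g|f g] G D;
  (* Negation and implication rules. The values of the side formulas and the four context disjuncts
     are treated as arbitrary, which leaves a finite truth table. *)
  try (by move=> P Q /=; rewrite !has_mset1U ?hI ?hN;
          case: (h f); try case: (h g); do 4 case: has);
  by case=> P Q /=; rewrite !has_mset1U ?hA ?hO;
     case: (h f); case: (h g); do 4 case: has.
Qed.

Theorem theorem1 (atom : choiceType) (prems : seq (bisequent atom))
    (concl : bisequent atom) (r : BSC_K3 prems concl) :
  List.Forall (@K3_valid atom) prems <-> K3_valid concl.
Proof.
split=> [/List.Forall_forall valid_prems h hP | valid_concl].
  apply/satisfiesP; rewrite -(BSC_K3_satisfies hP r).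
  elim: {r} prems valid_prems => //= B s IHs valid_Bs.
  apply/andP; split; first by apply/satisfiesP/valid_Bs => //; left.
  by apply: IHs => C Cs; apply: valid_Bs; right.
(* The rule instance concerns the whole list [prems], so it is used before the induction, whose
   invariant passes to tails. *)
have: forall h, K3_valuation h -> all (satisfiesb h) prems.
  move=> h hP; rewrite (BSC_K3_satisfies hP r).
  by apply/satisfiesP/valid_concl.
elim: {r} prems => [|B s IHs] sat_Bs; constructor.
  by move=> h /sat_Bs /andP[/satisfiesP].
by apply: IHs => h /sat_Bs /andP[].
Qed.
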